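(* Let $(X_{\alpha},\delta_{\alpha})_{\alpha\in I}$ be a collection, with $I\neq\emptyset$, of nonempty separated proximity spaces, let $(\coprod_{\alpha}X_{\alpha},\delta)$ be its coproduct, and let $(\overline{\coprod_{\alpha}X_{\alpha}},\delta^{*})$ be the Smirnov compactification of this coproduct. For each $\alpha$ let $(\mathfrak{X}_{\alpha},\delta_{\alpha}^{*})$ denote the Smirnov compactification of $(X_{\alpha},\delta_{\alpha})$, and let $(\coprod_{\alpha}\mathfrak{X}_{\alpha},\delta_{1})$ denote the coproduct of these Smirnov compactifications. Then $$\delta d\Big(\coprod_{\alpha}X_{\alpha}\Big)=\delta_{1}d\Big(\coprod_{\alpha}\mathfrak{X}_{\alpha}\Big)=\delta^{*}d\Big(\overline{\coprod_{\alpha}X_{\alpha}}\Big)=\dim\Big(\overline{\coprod_{\alpha}X_{\alpha}}\Big)=\sup_{\alpha}\dim(\mathfrak{X}_{\alpha})=\sup_{\alpha}\delta_{\alpha}d(X_{\alpha})=\sup_{\alpha}\delta_{\alpha}^{*}d(\mathfrak{X}_{\alpha}).$$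
   Context: A proximity on a set $X$ is a binary relation $\delta$ on the power set of $X$ such that for all $A,B,C\subseteq X$: (1) $A\delta B\Rightarrow B\delta A$; (2) $A\delta B\Rightarrow A,B\neq\emptyset$; (3) $A\cap B\neq\emptyset\Rightarrow A\delta B$; (4) $A\delta(B\cup C)\iff A\delta B$ or $A\delta C$; (5) if not $A\delta B$, then there is $E\subseteq X$ with not $A\delta E$ and not $(X\setminus E)\delta B$. It is separated if $\{x\}\delta\{y\}\iff x=y$. It induces a topology on $X$: $A$ is closed iff ($\{x\}\delta A$ implies $x\in A$). The coproduct of proximity spaces $(X_\alpha,\delta_\alpha)_{\alpha\in I}$ is the disjoint union $\coprod_\alpha X_\alpha$ with $A\delta B\iff A_\alpha\delta_\alpha B_\alpha$ for some $\alpha$, where $A_\alpha:=A\cap X_\alpha$. A cluster in a separated proximity space $(X,\delta)$ is a nonempty collection $\sigma$ of subsets of $X$ such that: (1) $A\delta B$ for all $A,B\in\sigma$; (2) if $C\delta A$ for all $A\in\sigma$ then $C\in\sigma$; (3) if $A\cup B\in\sigma$ then $A\in\sigma$ or $B\in\sigma$. Let $\mathfrak{X}$ be the set of all clusters; $C\subseteq X$ absorbs $\mathcal{A}\subseteq\mathfrak{X}$ if $C\in\sigma$ for every $\sigma\in\mathcal{A}$. Define $\mathcal{A}\delta^{*}\mathcal{B}$ iff $A\delta B$ for all $A,B\subseteq X$ absorbing $\mathcal{A},\mathcal{B}$ respectively. Then $(\mathfrak{X},\delta^{*})$ is a separated proximity space with compact Hausdorff induced topology, the Smirnov compactification of $(X,\delta)$,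 in which $X$ is densely and proximally embedded via $x\mapsto\{A\subseteq X:\{x\}\delta A\}$. The multiplicity of a cover of $X$ is the smallest number $m$ such that each $x\in X$ lies in at most $m$ elements of the cover. The covering dimension $\dim(X)$ of a nonempty topological space $X$ is the smallest non-negative integer $n$ such that each finite open cover of $X$ has a finite open refinement of multiplicity at most $n+1$, and $\dim(X)=\infty$ if no such $n$ exists. A $\delta$-covering of a proximity space $(X,\delta)$ is a finite collection $A_1,\dots,A_k\subseteq X$ for which there are $B_1,\dots,B_k\subseteq X$ with $\bigcup_{i\le k}B_i=X$ and, for each $i$, $B_i$ not $\delta$-close to $X\setminus A_i$. The $\delta$-dimension (proximity dimension) $\delta d(X)$ of a nonempty proximity space $(X,\delta)$ is the smallest non-negative integer $n$ such that each $\delta$-covering of $X$ has a refinement that is a $\delta$-covering of multiplicity at most $n+1$, and $\delta d(X)=\infty$ if no such $n$ exists. The notations $\delta_1 d$, $\delta^* d$, $\delta_\alpha d$, $\delta_\alpha^* d$ mean the same with respect to the indicated proximity. *)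

(* Defs.v *)
From HB Require Import structures.
From mathcomp Require Import all_boot all_order all_algebra.
From mathcomp Require Import all_classical all_reals topology ereal.

Set Implicit Arguments.
Unset Strict Implicit.
Unset Printing Implicit Defensive.
Import Order.TTheory GRing.Theory Num.Theory.
Local Open Scope classical_set_scope.
Local Open Scope ring_scope.

(* `prox A B` is the relation "A is close to B". *)
HB.mixin Record isProximity (X : Type) := {
  prox : set X -> set X -> Prop;
  prox_sym : forall A B, prox A B -> prox B A;
  prox_neq0 : forall A B, prox A B -> A !=set0 /\ B !=set0;
  prox_meet : forall A B, A `&` B !=set0 -> prox A B;
  proxU : forall A B C, prox A (B `|` C) <-> prox A B \/ prox A C;
  prox_strong : forall A B, ~ prox A B ->
    exists E, ~ prox A E /\ ~ prox (~` E) B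
}.

#[short(type="proximityType")]
HB.structure Definition Proximity := {X of isProximity X}.

Definition separated_prox (X : proximityType) : Prop :=
  forall x y : X, prox [set x] [set y] <-> x = y.

Section ProximityTheory.
Variable X : proximityType.
Implicit Types A B C : set X.

Lemma prox_subr A B C : B `<=` C -> prox A B -> prox A C.
Proof. by move=> BC AB; rewrite -((setUidPr B C).2 BC) proxU; left. Qed.

Lemma prox_sub A A' B B' : A `<=` A' -> B `<=` B' -> prox A B -> prox A' B'.
Proof.
by move=> AA' BB' /(prox_subr BB')/prox_sym/(prox_subr AA')/prox_sym.
Qed.

End ProximityTheory.

Definition prox_closed (X : proximityType) (A : set X) : Prop :=
  forall x, prox [set x] A -> A x.

(* X with the topology induced by its proximity; an alias, so that no topology
   is forced on the types that carry a proximity *)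
Definition induced (X : proximityType) : Type := X.

Section InducedTopology.
Variable X : proximityType.

HB.instance Definition _ := gen_eqMixin (induced X).
HB.instance Definition _ := gen_choiceMixin (induced X).

Definition induced_open : set_system (induced X) :=
  [set U | prox_closed (~` U : set X)].

Let induced_openT : induced_open setT.
Proof. by rewrite /induced_open/= setCT => x /prox_neq0[_ []]. Qed.

Let induced_openI : setI_closed induced_open.
Proof.
move=> A B oA oB; rewrite /induced_open/= setCI => x /proxU[].
  by move/oA; left.
by move/oB; right.
Qed.

Let induced_open_bigU (I : Type) (f : I -> set (induced X)) :
  (forall i, induced_open (f i)) -> induced_open (\bigcup_i f i).
Proof.
move=> of_ x xf [i _ fx]; apply: (of_ i) fx; apply: prox_subr xf.
by move=> y nfy fiy; apply: nfy; exists i.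
Qed.

HB.instance Definition _ := isOpenTopological.Build (induced X)
  induced_openT induced_openI induced_open_bigU.

Lemma induced_closedE (A : set (induced X)) :
  closed A = prox_closed (A : set X).
Proof. by rewrite -openC -[LHS]/(prox_closed (~` ~` A : set X)) setCK. Qed.

End InducedTopology.

Definition coproduct (I : Type) (X : I -> proximityType) : Type :=
  {a : I & X a}.

Section Coproduct.
Variables (I : Type) (X : I -> proximityType).
Implicit Types A B C : set (coproduct X).

Definition component A (a : I) : set (X a) := [set x | A (existT _ a x)].

Arguments component : clear implicits.

Definition coprox A B : Prop := exists a, prox (component A a) (component B a).

Let coprox_sym A B : coprox A B -> coprox B A.
Proof. by move=> [a /prox_sym ?]; exists a. Qed.

Let coprox_neq0 A B : coprox A B -> A !=set0 /\ B !=set0.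
Proof.
move=> [a /prox_neq0[[x Ax] [y By]]].
by split; [exists (existT _ a x)|exists (existT _ a y)].
Qed.

Let coprox_meet A B : A `&` B !=set0 -> coprox A B.
Proof. by move=> [[a x] [Ax Bx]]; exists a; apply: prox_meet; exists x. Qed.

Let coproxU A B C : coprox A (B `|` C) <-> coprox A B \/ coprox A C.
Proof.
split; first by move=> [a /proxU[?|?]]; [left|right]; exists a.
by move=> [[a ?]|[a ?]]; exists a; apply/proxU; [left|right].
Qed.

Let coprox_strong A B : ~ coprox A B ->
  exists E, ~ coprox A E /\ ~ coprox (~` E) B.
Proof.
move=> nAB.
have E_ a : {E : set (X a) |
    ~ prox (component A a) E /\ ~ prox (~` E) (component B a)}.
  by apply: cid; apply: prox_strong => AB; apply: nAB; exists a.
exists [set x : coproduct X | sval (E_ (projT1 x)) (projT2 x)].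
by split=> -[a]; have [] := svalP (E_ a).
Qed.

HB.instance Definition _ := isProximity.Build (coproduct X)
  coprox_sym coprox_neq0 coprox_meet coproxU coprox_strong.

Lemma coproduct_separated :
  (forall a, separated_prox (X a)) -> separated_prox (coproduct X).
Proof.
move=> sX p q; split=> [[a]|->]; last by apply: prox_meet; exists q.
move=> pq; have [[x /= xp] [y /= yq]] := prox_neq0 _ _ pq.
rewrite -xp -yq; congr existT; apply: (sX a x y).1.
apply: prox_sub pq => z /= zE.
- by apply: (@existT_inj2 {classic I} X); rewrite xp.
- by apply: (@existT_inj2 {classic I} X); rewrite yq.
Qed.

End Coproduct.
Arguments component {I X} A a.

Section Smirnov.
Variable X : proximityType.
Implicit Types (A B C : set X) (s : set (set X)).

Record is_cluster s : Prop := IsCluster {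
  cluster_nonempty : s !=set0;
  cluster_close : forall A B, s A -> s B -> prox A B;
  cluster_max : forall C, (forall A, s A -> prox C A) -> s C;
  cluster_prime : forall A B, s (A `|` B) -> s A \/ s B
}.

Definition smirnov : Type := {s : set (set X) | is_cluster s}.

Implicit Types S T U : set smirnov.

Definition absorbs C S : Prop := forall s : smirnov, S s -> sval s C.

Definition smirnov_prox S T : Prop :=
  forall A B, absorbs A S -> absorbs B T -> prox A B.

Lemma cluster_sub (s : smirnov) A B : A `<=` B -> sval s A -> sval s B.
Proof.
case: s => s sP /= AB sA; apply: (cluster_max sP) => C sC.
by apply: prox_sub AB _ (cluster_close sP sA sC).
Qed.

Lemma cluster_setT (s : smirnov) : sval s setT.
Proof.
by have [A sA] := cluster_nonempty (svalP s); apply: cluster_sub sA.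
Qed.

Lemma cluster_setVC (s : smirnov) E : sval s E \/ sval s (~` E).
Proof.
apply: (cluster_prime (svalP s)).
by rewrite setUv; exact: cluster_setT.
Qed.

Let smirnov_prox_sym S T : smirnov_prox S T -> smirnov_prox T S.
Proof. by move=> ST A B AT BS; apply/prox_sym/ST. Qed.

Let smirnov_prox_neq0 S T : smirnov_prox S T -> S !=set0 /\ T !=set0.
Proof.
have aT U : absorbs setT U by move=> s _; exact: cluster_setT.
move=> ST; split; apply: contrapT => /nonemptyPn U0.
- have a0 : absorbs set0 S by rewrite U0.
  by have [[]] := prox_neq0 _ _ (ST _ _ a0 (aT T)).
- have a0 : absorbs set0 T by rewrite U0.
  by have [_ []] := prox_neq0 _ _ (ST _ _ (aT S) a0).
Qed.

Let smirnov_prox_meet S T : S `&` T !=set0 -> smirnov_prox S T.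
Proof.
move=> [s [Ss Ts]] A B /(_ _ Ss) sA /(_ _ Ts).
by apply: (cluster_close (svalP s)).
Qed.

Let smirnov_proxU S T U :
  smirnov_prox S (T `|` U) <-> smirnov_prox S T \/ smirnov_prox S U.
Proof.
split; last first.
  by move=> [] ST A B aA aB; apply: ST => // s sT; apply: aB; [left|right].
move=> STU; apply: contrapT => /not_orP[].
move=> /existsNP[A /existsNP[B /not_implyP[aA /not_implyP[aB nAB]]]].
move=> /existsNP[A' /existsNP[C /not_implyP[aA' /not_implyP[aC nAC]]]].
have [E [nAE nEB]] := prox_strong _ _ nAB.
have [F [nAF nFC]] := prox_strong _ _ nAC.
have aEF : absorbs (~` E `&` ~` F) S.
  move=> s Ss; rewrite -setCU; case: (cluster_setVC s (E `|` F)) => // sEF.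
  have [sE|sF] := cluster_prime (svalP s) sEF.
  - by case: nAE; apply: (cluster_close (svalP s)) => //; exact: aA.
  - by case: nAF; apply: (cluster_close (svalP s)) => //; exact: aA'.
have aBC : absorbs (B `|` C) (T `|` U).
  move=> s [/aB|/aC]; apply: cluster_sub; [exact: subsetUl|exact: subsetUr].
have /proxU[h|h] := STU _ _ aEF aBC.
- by apply: nEB; apply: prox_sub h => // x [].
- by apply: nFC; apply: prox_sub h => // x [].
Qed.

Let smirnov_prox_strong S T : ~ smirnov_prox S T ->
  exists U, ~ smirnov_prox S U /\ ~ smirnov_prox (~` U) T.
Proof.
move=> /existsNP[A /existsNP[B /not_implyP[aA /not_implyP[aB nAB]]]].
have [E [nAE nEB]] := prox_strong _ _ nAB.
exists [set s : smirnov | sval s E]; split=> h.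
- by apply: nAE; apply: h.
- apply: nEB; apply: h => // s /= nsE.
  by case: (cluster_setVC s E).
Qed.

HB.instance Definition _ := isProximity.Build smirnov
  smirnov_prox_sym smirnov_prox_neq0 smirnov_prox_meet smirnov_proxU
  smirnov_prox_strong.

Lemma smirnov_separated : separated_prox smirnov.
Proof.
move=> s t; split=> [st|->]; last by apply: prox_meet; exists t.
have stA A B : sval s A -> sval t B -> prox A B.
  by move=> sA tB; apply: st => _ ->.
case: s t stA {st} => [s sP] [t tP] /= stA; apply: eq_exist.
apply/seteqP; split=> A.
- by move=> sA; apply: (cluster_max tP) => B; exact: stA.
- by move=> tA; apply: (cluster_max sP) => B sB; apply: prox_sym; exact: stA.
Qed.

End Smirnov.

Section Dimension.
Variable R : realType.

(* the smallest natural number satisfying P, and +oo if there is none *)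
Definition least (P : nat -> Prop) : \bar R :=
  match pselect (exists n, `[< P n >]) with
  | left exP => (ex_minn exP)%:R%:E
  | right _ => +oo%E
  end.

(* Covers are sets of sets, so the members containing x are counted without
   repetition. *)
Definition multiplicity (X : Type) (U : set (set X)) : \bar R :=
  least (fun m => forall x, ([set A | U A /\ A x] #<= `I_m)%card).

Definition refines (X : Type) (V U : set (set X)) : Prop :=
  forall B, V B -> exists2 A, U A & B `<=` A.

Definition finite_open_cover (T : topologicalType) (U : set (set T)) : Prop :=
  [/\ finite_set U, U `<=` open & \bigcup_(A in U) A = setT].

Definition covering_dim (T : topologicalType) : \bar R :=
  least (fun n => forall U : set (set T), finite_open_cover U ->
    exists V, [/\ finite_open_cover V, refines V U
                & (multiplicity V <= n.+1%:R%:E)%E]).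

Definition delta_covering (X : proximityType) (U : set (set X)) : Prop :=
  exists k (A B : 'I_k -> set X),
    [/\ U = range A, \bigcup_i B i = setT & forall i, ~ prox (B i) (~` A i)].

Definition proximity_dim (X : proximityType) : \bar R :=
  least (fun n => forall U : set (set X), delta_covering U ->
    exists V, [/\ delta_covering V, refines V U
                & (multiplicity V <= n.+1%:R%:E)%E]).

End Dimension.

(* Main.v *)
Require Import Defs.
From mathcomp Require Import all_boot all_order all_algebra.
From mathcomp Require Import all_classical all_reals topology ereal.

Import Order.TTheory GRing.Theory Num.Theory.
Local Open Scope classical_set_scope.

(** Three facts give all six equalities.

    - A proximity space and its Smirnov compactification have the same
      proximity dimension ([proximity_dim_smirnov]).  A set [A] of [X] extends
      to the set of the clusters that omit [~` A].  This extension and the trace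
      along the embedding [x |-> {A | {x} close to A}] both turn
      delta-coverings into delta-coverings, and neither raises the
      multiplicity: by primeness, if finitely many extensions have a common
      cluster then the sets themselves have a common point.

    - On a Smirnov compactification the proximity dimension is the covering
      dimension ([covering_dim_smirnov]).  This is where compactness enters: a
      finite open cover of a compact proximity space is a delta-covering
      ([finite_open_cover_delta]).  Conversely, shrinking the members of a
      delta-covering to their interiors gives an open cover.

    - The proximity dimension of a coproduct is the supremum of the proximity
      dimensions of the summands ([proximity_dim_coproduct]).  The difficulty is
      that the refinements found on the infinitely many summands have unbounded
      sizes, while a delta-covering is finite.  Merging the members of each
      refinement that are assigned to the same member of the given covering
      yields refinements indexed by that covering ([indexed_refinement]), and
      these can be glued together.

    Each fact is proved as an equivalence, for every [n], between statements
    of the form: every covering has a refinement of multiplicity at most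
    [n.+1].  Such equivalences yield equalities of dimensions through [eq_least]
    and [least_forall]. *)

(** * Least natural numbers and suprema *)

Section Least.
Variable R : realType.
Implicit Types (P Q : nat -> Prop).

Definition upward P : Prop := forall m n, (m <= n)%N -> P m -> P n.

Lemma eq_least P Q : (forall n, P n <-> Q n) -> least R P = least R Q.
Proof. by move=> PQ; congr least; apply/funext => n; apply/propext. Qed.

Lemma least_le P n : P n -> (least R P <= n%:R%:E)%E.
Proof.
move=> Pn; rewrite /least; case: pselect => [exP|[]]; last first.
  by exists n; apply/asboolP.
case: ex_minnP => m _ m_min; rewrite lee_fin ler_nat.
by apply: m_min; apply/asboolP.
Qed.

Lemma least_ge P m : (forall n, P n -> (m <= n)%N) ->
  (m%:R%:E <= least R P)%E.
Proof.
move=> mP; rewrite /least; case: pselect => [exP|_]; last exact: leey.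
by case: ex_minnP => n /asboolP/mP mn _; rewrite lee_fin ler_nat.
Qed.

Lemma least_leP P n : upward P -> (least R P <= n%:R%:E)%E <-> P n.
Proof.
move=> uP; split; last exact: least_le.
rewrite /least; case: pselect => [exP|_]; last by rewrite leye_eq.
case: ex_minnP => m /asboolP Pm _; rewrite lee_fin ler_nat => mn.
exact: uP Pm.
Qed.

(** A sup of least elements is the least common element: if [n] is not common
    then some [Q a] fails at [n], and being upward closed it then has its least
    element above [n]. *)
Lemma least_forall (I : Type) P (Q : I -> nat -> Prop) :
  inhabited I -> (forall a, upward (Q a)) ->
  (forall n, P n <-> forall a, Q a n) ->
  least R P = ereal_sup (range (fun a => least R (Q a))).
Proof.
move=> [a0] uQ PQ; apply/eqP; rewrite eq_le; apply/andP; split; last first.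
  apply/ereal_supP => _ [a _ <-].
  rewrite {2}/least; case: pselect => [exP|_]; last exact: leey.
  by case: ex_minnP => n /asboolP /PQ Qn _; apply: least_le.
(* This one bound serves both when [P] has a least element and when the supremum
   must be shown to exceed every real number. *)
have sup_ge m : (forall n, P n -> (m <= n)%N) ->
    (m%:R%:E <= ereal_sup (range (fun a => least R (Q a))))%E.
  case: m => [_|m mP].
    by apply: le_ereal_sup_tmp; exists (least R (Q a0)); [exists a0|
      exact: least_ge].
  have [a nQ] : exists a, ~ Q a m.
    by apply/existsNP => /PQ/mP; rewrite ltnn.
  apply: le_ereal_sup_tmp; exists (least R (Q a)); first by exists a.
  apply: least_ge => n Qn; rewrite ltnNge; apply/negP => nm.
  by apply: nQ; apply: uQ nm Qn.
rewrite {1}/least; case: pselect => [exP|noP].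
  case: ex_minnP => m _ m_min; apply: sup_ge => n Pn.
  by apply: m_min; apply/asboolP.
rewrite leye_eq; apply/eqP/eqyP => r r_gt0.
apply: (@le_trans _ _ (Num.bound r)%:R%:E).
  by rewrite lee_fin ltW// archi_boundP// ltW.
by apply: sup_ge => n Pn; case: noP; exists n; apply/asboolP.
Qed.

End Least.

(** * Multiplicity and dimension as predicates on natural numbers *)

Section Thin.

Definition thin {X : Type} (n : nat) (U : set (set X)) : Prop :=
  forall x, ([set A | U A /\ A x] #<= `I_n)%card.

Lemma thin_upward (X : Type) (U : set (set X)) : upward (thin ^~ U).
Proof.
by move=> m n mn Um x; apply: card_le_trans (Um x) _; rewrite card_le_II.
Qed.

Lemma multiplicity_le (R : realType) (X : Type) (U : set (set X)) n :
  (multiplicity R U <= n%:R%:E)%E <-> thin n U.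
Proof. exact: (least_leP R _ n (thin_upward X U)). Qed.

(** Distinct images come from distinct members, so it suffices to send every
    [y] to a point [x] that lies in all the members whose image contains [y]. *)
Lemma thin_image (X Y : Type) (f : set X -> set Y) n (V : set (set X)) :
  (forall y, exists x, forall A, V A -> f A y -> A x) ->
  thin n V -> thin n (f @` V).
Proof.
move=> fV Vn y; have [x xP] := fV y.
apply: card_le_trans (Vn x); apply: card_le_trans (card_image_le f _).
apply: subset_card_le => _ [[A VA <-] fAy].
by exists A => //; split=> //; exact: xP.
Qed.

End Thin.

Definition prox_dim_le (X : proximityType) (n : nat) : Prop :=
  forall U : set (set X), delta_covering U ->
  exists V, [/\ delta_covering V, refines V U & thin n.+1 V].

Definition covering_dim_le (T : topologicalType) (n : nat) : Prop :=
  forall U : set (set T), finite_open_cover U ->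
  exists V, [/\ finite_open_cover V, refines V U & thin n.+1 V].

Lemma prox_dim_le_upward (X : proximityType) : upward (prox_dim_le X).
Proof.
move=> m n mn dX U /dX[V [dV VU Vm]]; exists V; split=> //.
by apply: thin_upward Vm; rewrite ltnS.
Qed.

Lemma proximity_dimE (R : realType) (X : proximityType) :
  proximity_dim R X = least R (prox_dim_le X).
Proof.
apply: eq_least => n; split=> dX U /dX[V [dV VU Vm]]; exists V; split=> //.
- exact/(multiplicity_le R).
- exact/multiplicity_le.
Qed.

Lemma covering_dimE (R : realType) (T : topologicalType) :
  covering_dim R T = least R (covering_dim_le T).
Proof.
apply: eq_least => n; split=> dT U /dT[V [dV VU Vm]]; exists V; split=> //.
- exact/(multiplicity_le R).
- exact/multiplicity_le.
Qed.

(** * Delta-coverings *)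

Lemma bigcup_finite_ind (J : choiceType) (T : Type) (D : set J)
    (B : J -> set T) (P : set T -> Prop) :
  finite_set D -> P set0 -> (forall A C, P A -> P C -> P (A `|` C)) ->
  (forall j, D j -> P (B j)) -> P (\bigcup_(j in D) B j).
Proof.
move=> finD P0 PU PB; rewrite -bigsetU_fset_set// big_seq.
by apply: big_ind => // j; rewrite in_fset_set// inE; exact: PB.
Qed.

Section Far.
Variable X : proximityType.
Implicit Types A B C : set X.

Lemma far_bigcup (J : choiceType) (D : set J) (B : J -> set X) C :
  finite_set D -> (forall j, D j -> ~ prox (B j) C) ->
  ~ prox (\bigcup_(j in D) B j) C.
Proof.
move=> finD; apply: (bigcup_finite_ind _ _ _ _ (fun A => ~ prox A C)) => //.
- by move=> /prox_neq0[[]].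
- by move=> A A' nA nA' /prox_sym/proxU[] /prox_sym.
Qed.

(** The interior of [A] for the topology that the proximity induces. *)
Definition prox_interior A : set X := [set x | ~ prox [set x] (~` A)].

Lemma prox_interior_sub A : prox_interior A `<=` A.
Proof.
by move=> x xA; apply: contrapT => nAx; apply: xA; apply: prox_meet; exists x.
Qed.

(** The separating set [E] of the strong axiom contains every point outside the
    interior of [A], for such a point is close to [~` A]. *)
Lemma far_interior A B : ~ prox B (~` A) -> ~ prox B (~` prox_interior A).
Proof.
move=> nBA; have [E [nBE nEA]] := prox_strong _ _ nBA => BA.
apply: nBE; apply: prox_subr BA => x /contrapT xA.
by apply: contrapT => nEx; apply: nEA; apply: prox_sub xA => // _ ->.
Qed.

Lemma open_prox_interior A : open (prox_interior A : set (induced X)).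
Proof.
change (prox_closed (~` prox_interior A)) => x xA; apply: contrapT => /contrapT.
by move/far_interior.
Qed.

Lemma delta_covering_finite (U : set (set X)) :
  delta_covering U -> finite_set U.
Proof. by move=> [k [A [B [-> _ _]]]]; apply: finite_image. Qed.

(** A finite cover whose shrinking is indexed by its own members; an
    enumeration turns it into one indexed by ordinals. *)
Lemma delta_coveringW (U : set (set X)) (B : set X -> set X) :
  finite_set U -> \bigcup_(A in U) B A = setT ->
  (forall A, U A -> ~ prox (B A) (~` A)) -> delta_covering U.
Proof.
move=> /finite_seqP[s ->] cB fB.
exists (size s), (tnth (in_tuple s)), (fun i => B (tnth (in_tuple s) i)).
split.
- apply/seteqP; split=> [A|_ [i _ <-]]; last exact: mem_tnth.
  by move=> /= /(tnthP (in_tuple s))[i ->]; exists i.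
- rewrite -subTset => x _.
  have [A /= /(tnthP (in_tuple s))[i ->] Bx] : (\bigcup_(A in [set` s]) B A) x
    by rewrite cB.
  by exists i.
- by move=> i; apply: fB; exact: mem_tnth.
Qed.

End Far.

(** Here [f] acts on the members of a covering and [g] on its shrinking; the two
    differ when a covering is extended to the space of clusters. *)
Lemma delta_covering_image (X Y : proximityType) (f g : set X -> set Y)
    (U : set (set X)) :
  (forall A B, ~ prox B (~` A) -> ~ prox (g B) (~` f A)) ->
  (forall k (B : 'I_k -> set X),
     \bigcup_i B i = setT -> \bigcup_i g (B i) = setT) ->
  delta_covering U -> delta_covering (f @` U).
Proof.
move=> fg gT [k [A [B [-> BT nBA]]]].
exists k, (f \o A), (g \o B); split=> [||i]; last exact: fg.
- by rewrite image_comp.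
- exact: gT.
Qed.

Definition prox_map {X Y : proximityType} (h : X -> Y) : Prop :=
  forall A B, prox A B -> prox (h @` A) (h @` B).

Lemma delta_covering_preimage (X Y : proximityType) (h : X -> Y)
    (U : set (set Y)) :
  prox_map h -> delta_covering U -> delta_covering (preimage h @` U).
Proof.
move=> ph.
apply: (delta_covering_image _ _ _ (preimage h)) => [A B nBA hBA|k B BT].
  apply: nBA; apply: prox_sub (ph _ _ hBA); exact: image_preimage_subset.
by rewrite -preimage_bigcup BT preimage_setT.
Qed.

Lemma thin_preimage (X Y : Type) (h : X -> Y) n (U : set (set Y)) :
  thin n U -> thin n (preimage h @` U).
Proof. by apply: thin_image => x; exists (h x). Qed.

(** * Clusters of ultrafilters and the canonical embedding *)

Section Clusters.
Variable X : proximityType.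
Implicit Types (A B : set X) (F : set_system X).

Definition ultra_cluster F : set (set X) :=
  [set A | forall B, F B -> prox A B].

Lemma sub_ultra_cluster F : ProperFilter F -> F `<=` ultra_cluster F.
Proof.
move=> FF A FA B FB; apply: prox_meet; exact: (filter_ex (filterI FA FB)).
Qed.

(** An ultrafilter contains [E] or [~` E] for each [E]; against the strong axiom
    this makes any two sets of the collection close. *)
Lemma is_cluster_ultra F : UltraFilter F -> is_cluster (ultra_cluster F).
Proof.
move=> UF; have FF : ProperFilter F := ultra_proper; split.
- by exists setT; apply: sub_ultra_cluster; exact: filterT.
- move=> A B sA sB; apply: contrapT => /prox_strong[E [nAE nEB]].
  have [/sA//|/sB EB] := in_ultra_setVsetC E UF.
  by apply: nEB; exact: prox_sym.
- move=> C CF A FA; apply: CF; exact: sub_ultra_cluster.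
- move=> A B sAB; apply: contrapT => /not_orP[].
  move=> /existsNP[A' /not_implyP[FA' nA]] /existsNP[B' /not_implyP[FB' nB]].
  have /sAB/prox_sym/proxU[/prox_sym h|/prox_sym h] : F (A' `&` B').
    exact: filterI.
  + by apply: nA; apply: prox_subr h => ? [].
  + by apply: nB; apply: prox_subr h => ? [].
Qed.

(** Exposes the quantifiers over absorbing sets, which unfolding the canonical
    structure of [smirnov X] leaves buried under local definitions. *)
Lemma smirnov_proxE (S T : set (smirnov X)) : prox S T = smirnov_prox S T.
Proof. by []. Qed.

(** The sets close to a point are the cluster of its principal ultrafilter. *)
Definition point_cluster (x : X) : smirnov X :=
  exist _ _ (is_cluster_ultra _ (principal_filter_ultra x)).

Lemma point_clusterE x A : sval (point_cluster x) A <-> prox [set x] A.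
Proof.
split=> [|xA B /principal_filterP Bx]; first by move=> /(_ [set x]) h;
  apply/prox_sym/h/principal_filterP.
by apply/prox_sym; apply: prox_sub xA => // _ ->.
Qed.

Lemma absorbs_point_cluster A : absorbs A (point_cluster @` A).
Proof. by move=> _ [x Ax <-]; apply/point_clusterE/prox_meet; exists x. Qed.

Lemma far_absorbed A C E : absorbs C (point_cluster @` A) -> ~ prox C E ->
  A `<=` ~` E.
Proof.
move=> aC nCE x Ax Ex; apply: nCE.
have /point_clusterE/prox_sym : sval (point_cluster x) C by apply: aC; exists x.
by apply: prox_subr => _ ->.
Qed.

(** If sets absorbing the images of [A] and [B] were far apart, then two uses of
    the strong axiom would enclose [A] and [B] in sets that are far apart. *)
Lemma prox_map_point_cluster : prox_map point_cluster.
Proof.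
move=> A B AB; rewrite smirnov_proxE => C D aC aD.
apply: contrapT => /prox_strong[E [nCE nED]].
have [F [nDF nFE]] := prox_strong _ _ (fun DE => nED (prox_sym _ _ DE)).
apply: nFE; apply/prox_sym; apply: prox_sub AB.
- exact: far_absorbed aC nCE.
- exact: far_absorbed aD nDF.
Qed.

End Clusters.

(** * Dimension of the Smirnov compactification *)

Section SmirnovDim.
Variable X : proximityType.
Implicit Types (A B : set X).

Definition star A : set (smirnov X) := [set s | sval s A].

(** The largest open set of clusters whose trace on [X] lies in [A]. *)
Definition open_extension A : set (smirnov X) := [set s | ~ sval s (~` A)].

Lemma cluster_n0 (s : smirnov X) : ~ sval s set0.
Proof.
by move=> s0; have [[]] := prox_neq0 _ _ (cluster_close (svalP s) s0 s0).
Qed.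

Lemma far_smirnov (S T : set (smirnov X)) : ~ prox S T ->
  exists C D, [/\ absorbs C S, absorbs D T & ~ prox C D].
Proof.
rewrite smirnov_proxE => /existsNP[C /existsNP[D]].
by move=> /not_implyP[aC /not_implyP[aD nCD]]; exists C, D.
Qed.

Lemma cluster_bigcup (J : choiceType) (D : set J) (B : J -> set X)
    (s : smirnov X) : finite_set D -> sval s (\bigcup_(j in D) B j) ->
  exists2 j, D j & sval s (B j).
Proof.
move=> finD sB; apply: contrapT => /forall2NP nB; move: sB.
apply: (bigcup_finite_ind _ _ _ _ (fun A => ~ sval s A)) => //.
- exact: cluster_n0.
- by move=> A C nA nC /(cluster_prime (svalP s))[].
- by move=> j Dj; have [] := nB j.
Qed.

Lemma delta_covering_open_extension (U : set (set X)) :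
  delta_covering U -> delta_covering (open_extension @` U).
Proof.
apply: (delta_covering_image _ _ _ star) => [A B nBA h|k B BT].
  by rewrite smirnov_proxE in h; apply: nBA; apply: h => // s /contrapT.
rewrite -subTset => s _.
have : sval s (\bigcup_i B i) by rewrite BT; exact: cluster_setT.
move=> sB; have [i _ sBi] := cluster_bigcup _ _ _ _ (finite_finset) sB.
by exists i.
Qed.

(** If the members whose extensions contain [s] had no common point, then their
    complements would cover [X]; finiteness and primeness would then put one of
    these complements in [s]. *)
Lemma thin_open_extension n (U : set (set X)) : finite_set U ->
  thin n U -> thin n (open_extension @` U).
Proof.
move=> finU; apply: thin_image => s; apply: contrapT => /forallNP nx.
have : sval s (\bigcup_(A in U `&` [set A | open_extension A s]) ~` A).
  apply: cluster_sub (cluster_setT s) => x _.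
  have /existsNP[A /not_implyP[UA /not_implyP[sA nAx]]] := nx x.
  by exists A.
move=> sU; have [|A []//] := cluster_bigcup _ _ _ s _ sU.
exact: finite_setIl.
Qed.

Lemma trace_open_extension A : point_cluster X @^-1` open_extension A `<=` A.
Proof. by move=> x /= xA; apply: prox_interior_sub => /point_clusterE. Qed.

(** Going up, the covering of [X] to refine is not the trace of the given one but
    the slightly smaller sets [~` D i], with [D i] absorbing [~` A i]: the
    extension of a subset of [~` D i] lies in [A i], whereas the extension of the
    trace of [A i] might not. *)
Lemma prox_dim_le_smirnov n : prox_dim_le X n <-> prox_dim_le (smirnov X) n.
Proof.
split=> dX U.
  move=> [k [A [B [-> BT nBA]]]].
  have /choice[D DP] i : exists D, absorbs D (~` A i) /\
      exists2 C, absorbs C (B i) & ~ prox C D.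
    have [C [D [aC aD nCD]]] := far_smirnov _ _ (nBA i).
    by exists D; split=> //; exists C.
  have [|V [dV VD Vn]] := dX (range (fun i => ~` D i)).
    exists k, (fun i => ~` D i), (fun i => point_cluster X @^-1` B i).
    split=> [//||i]; first by rewrite -preimage_bigcup BT preimage_setT.
    rewrite setCK => BD; have [_ [C aC nCD]] := DP i; apply: nCD.
    apply: (prox_map_point_cluster _ _ _ BD); last exact: absorbs_point_cluster.
    by move=> _ [x Bx <-]; exact: aC.
  exists (open_extension @` V); split.
  - exact: delta_covering_open_extension.
  - move=> _ [W VW <-]; have [_ [i _ <-] WD] := VD W VW.
    exists (A i); first by exists i.
    move=> s; apply: contra_notP => nAs; have [aD _] := DP i.
    by apply: cluster_sub (aD s nAs) => x Dx /WD.
  - by apply: thin_open_extension => //; exact: delta_covering_finite.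
move=> /delta_covering_open_extension/dX[V [dV VU Vn]].
exists (preimage (point_cluster X) @` V); split.
- by apply: delta_covering_preimage => //; exact: prox_map_point_cluster.
- move=> _ [W VW <-]; have [_ [A UA <-] WA] := VU W VW; exists A => //.
  by move=> x /WA; exact: trace_open_extension.
- exact: thin_preimage.
Qed.

(** Compactness of the space of clusters, in the form in which dimension theory
    uses it.  Call [W] small when the clusters containing [W] can be covered by
    sets far from the complements of the members of [U]; the claim is that [setT]
    is small.  Small sets form an ideal, so otherwise their complements lie in an
    ultrafilter.  Its cluster [s] lies in some open member [S], and the strong
    axiom yields a set [~` E] that is small, because far from a set absorbing
    [~` S], and yet has its complement [E] far from a set in [s]. *)
Lemma finite_open_cover_delta (U : set (set (induced (smirnov X)))) :
  finite_open_cover U -> delta_covering (U : set (set (smirnov X))).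
Proof.
move=> [finU openU coverU].
pose shrinks (W : set X) (B : set (smirnov X) -> set (smirnov X)) :=
  (forall S, U S -> ~ prox (B S) (~` S)) /\
  star W `<=` \bigcup_(S in U) B S.
suff [B [Bfar Bcov]] :
    exists B : set (smirnov X) -> set (smirnov X), shrinks setT B.
  apply: (delta_coveringW _ _ B) => //.
  by rewrite -subTset => s _; apply: Bcov; exact: cluster_setT.
apply: contrapT => nT.
pose F : set_system X :=
  [set W | exists B : set (smirnov X) -> set (smirnov X), shrinks (~` W) B].
have FF : ProperFilter F.
  split; first by rewrite /F /= setC0.
  split.
  - exists (fun=> set0); split=> [S _ /prox_neq0[[]]//|s].
    by rewrite setCT => /cluster_n0.
  - move=> P Q [B [Bfar Bcov]] [C [Cfar Ccov]].
    exists (fun S => B S `|` C S); split.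
      by move=> S US /prox_sym/proxU[] /prox_sym; [exact: Bfar|exact: Cfar].
    move=> s; rewrite /star /= setCI => /(cluster_prime (svalP s))[].
    + by move=> /Bcov[S US BS]; exists S => //; left.
    + by move=> /Ccov[S US CS]; exists S => //; right.
  - move=> P Q PQ [B [Bfar Bcov]]; exists B; split=> // s sQ; apply: Bcov.
    by apply: cluster_sub sQ; exact: subsetC.
have [G [UG FG]] := ultraFilterLemma FF.
pose s : smirnov X := exist _ _ (is_cluster_ultra _ _ UG).
have [S US Ss] : (\bigcup_(S in U) S) s by rewrite coverU.
have /far_smirnov[C [D [aC aD /prox_strong[E [nCE nED]]]]] :
    ~ prox [set s] (~` S : set (smirnov X)).
  by move=> sS; apply: (openU S US s sS).
have /(_ _ _)/= sC : sval s C by apply: aC.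
apply: nCE; apply: sC; apply: FG.
exists (fun T => if `[< T = S >] then star (~` E) else set0); split.
- move=> T UT; case: asboolP => [-> |_ /prox_neq0[[]]//].
  by rewrite smirnov_proxE => h; apply: nED; apply: h => // t.
- by move=> t tE; exists S => //; case: asboolP.
Qed.

Lemma prox_dim_le_covering n :
  prox_dim_le (smirnov X) n <-> covering_dim_le (induced (smirnov X)) n.
Proof.
have openI (V : set (set (smirnov X))) : delta_covering V ->
    finite_open_cover
      (@prox_interior (smirnov X) @` V : set (set (induced (smirnov X)))).
  move=> dV; split.
  - by apply: finite_image; exact: delta_covering_finite.
  - by move=> _ [A _ <-]; exact: open_prox_interior.
  - rewrite -subTset => s _; have [k [A [B [-> BT nBA]]]] := dV.
    have [i _ Bis] : (\bigcup_i B i) s by rewrite BT.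
    exists (prox_interior (smirnov X) (A i)).
      by exists (A i) => //; exists i.
    by move=> sA; apply: (nBA i); apply: prox_sub sA => // _ ->.
split=> dX U.
  move=> /finite_open_cover_delta/dX[V [dV VU Vn]].
  exists (@prox_interior (smirnov X) @` V); split; first exact: openI.
  - move=> _ [W VW <-]; have [A UA WA] := VU W VW; exists A => //.
    by move=> s /prox_interior_sub/WA.
  - by apply: thin_image Vn => s; exists s => A _; exact: prox_interior_sub.
move=> /openI/dX[V [dV VU Vn]]; exists V; split=> //.
  exact: finite_open_cover_delta.
move=> W VW; have [_ [A UA <-] WA] := VU W VW; exists A => //.
by move=> s /WA; exact: prox_interior_sub.
Qed.

End SmirnovDim.

(** * Dimension of a coproduct *)

Section CoproductDim.

(** Merging the members of [V] that are assigned to the same index.  A point of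
    the [j]-th union lies in a member assigned to [j], so it lies in at most as
    many unions as members.  The assignment is a function of the member and not
    of its position in an enumeration of [V]: repetitions in the enumeration
    could otherwise put equal members in different unions.  The multiplicity is
    counted on indices, because unions that agree on one summand of a coproduct
    may differ on another. *)
Lemma indexed_refinement (X : proximityType) (J : finType) (j0 : J)
    (A : J -> set X) (V : set (set X)) n :
  delta_covering V -> refines V (range A) -> thin n V ->
  exists V' W : J -> set X,
    [/\ forall j, V' j `<=` A j, \bigcup_j W j = setT,
        forall j, ~ prox (W j) (~` V' j)
      & forall x, ([set j | V' j x] #<= `I_n)%card].
Proof.
move=> [k [C [D [-> DT nDC]]]] VA Vn.
have /choice[f fP] (S : set X) : exists j, range C S -> S `<=` A j.
  have [/VA[_ [j _ <-] SA]|nS] := pselect (range C S); first by exists j.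
  by exists j0.
exists (fun j => \bigcup_(i in [set i | f (C i) = j]) C i).
exists (fun j => \bigcup_(i in [set i | f (C i) = j]) D i).
split.
- by move=> j x [i /= <- Cix]; apply: fP Cix; exists i.
- rewrite -subTset => x _.
  have [i _ Dix] : (\bigcup_i D i) x by rewrite DT.
  by exists (f (C i)) => //; exists i.
- move=> j; apply: far_bigcup => [|i /= ij].
    exact: finite_finset.
  move=> h; apply: (nDC i); apply: prox_subr h; apply: subsetC => x Cix.
  by exists i.
- move=> x; apply: card_le_trans (Vn x); apply: card_le_trans (card_image_le f _).
  apply: subset_card_le => j [i /= <- Cix]; exists (C i) => //.
  by split=> //; exists i.
Qed.

Variables (I : Type) (X : I -> proximityType).

Lemma prox_map_existT a : @prox_map (X a) (coproduct X) (existT X a).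
Proof.
by move=> A B AB; exists a; apply: prox_sub AB => x ?; exists x.
Qed.

(** The union of [A] with all the other summands.  Adding them to every member
    makes a covering of [X a] into a covering of the coproduct, and the parts
    added have empty complement in their own summands. *)
Definition extend a (A : set (X a)) : set (coproduct X) :=
  [set p | forall x, p = existT X a x -> A x].

(** Injectivity of [existT] holds over types with decidable equality; the alias
    [{classic I}] gives such an equality to an arbitrary [I]. *)
Lemma component_extend a (A : set (X a)) : component (extend a A) a = A.
Proof.
apply/seteqP; split=> x; first by apply.
by move=> Ax y /(@existT_inj2 {classic I} X) <-.
Qed.

Lemma delta_covering_extend a (U : set (set (X a))) : inhabited (X a) ->
  delta_covering U -> delta_covering (extend a @` U).
Proof.
move=> [x0]; apply: (delta_covering_image _ _ _ (extend a)).
  move=> A B nBA [b]; have [ab|ab] := pselect (a = b).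
    subst b; rewrite component_extend => h; apply: nBA; apply: prox_subr h.
    by move=> x; apply: contra_not => Ax y /(@existT_inj2 {classic I} X) <-.
  move=> /prox_neq0[_ [x]]; apply => y xy; case: ab.
  exact: (esym (f_equal (@projT1 _ _) xy)).
move=> k B BT; rewrite -subTset => p _.
have [[x ->]|np] := pselect (exists x, p = existT X a x).
  have [i _ Bx] : (\bigcup_i B i) x by rewrite BT.
  by exists i => // y /(@existT_inj2 {classic I} X) <-.
have [i _ _] : (\bigcup_i B i) x0 by rewrite BT.
by exists i => // x px; case: np; exists x.
Qed.

Lemma prox_dim_le_coproduct n :
  inhabited I -> (forall a, inhabited (X a)) ->
  prox_dim_le (coproduct X) n <-> forall a, prox_dim_le (X a) n.
Proof.
move=> [a0] X0; split=> [dX a U|dX _ [k [A [B [-> BT nBA]]]]].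
  move=> /(delta_covering_extend a _ (X0 a))/dX[V [dV VU Vn]].
  exists (preimage (existT X a) @` V); split.
  - by apply: delta_covering_preimage => //; exact: prox_map_existT.
  - move=> _ [W VW <-]; have [_ [C UC <-] WC] := VU W VW; exists C => //.
    by rewrite -[X in _ `<=` X]component_extend => x /WC.
  - exact: thin_preimage.
(* Nonemptiness of the coproduct makes the index type ['I_k] inhabited. *)
have [x0] := X0 a0.
have [j0 _ _] : (\bigcup_i B i) (existT X a0 x0) by rewrite BT.
have VWP a : {VW : ('I_k -> set (X a)) * ('I_k -> set (X a)) |
    [/\ forall j, VW.1 j `<=` component (A j) a, \bigcup_j VW.2 j = setT,
        forall j, ~ prox (VW.2 j) (~` VW.1 j)
      & forall x, ([set j | VW.1 j x] #<= `I_n.+1)%card]}.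
  apply: cid.
  have [|V [dV VA Vn]] := dX a (range (fun j => component (A j) a)).
    exists k, (fun j => component (A j) a), (fun j => component (B j) a).
    split=> // [|j h]; last by apply: (nBA j); exists a.
    rewrite -subTset => x _.
    have [i _ Bi] : (\bigcup_i B i) (existT X a x) by rewrite BT.
    by exists i.
  have [V' [W VWP]] := indexed_refinement _ _ j0 _ _ _ dV VA Vn.
  by exists (V', W).
pose V j : set (coproduct X) := [set p | (sval (VWP (projT1 p))).1 j (projT2 p)].
pose W j : set (coproduct X) := [set p | (sval (VWP (projT1 p))).2 j (projT2 p)].
exists (range V); split.
- exists k, V, W; split=> [//||j [a]]; last first.
    by have [_ _ + _] := svalP (VWP a); apply.
  rewrite -subTset => -[a x] _.
  have [_ WT _ _] := svalP (VWP a).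
  have [j _ Wx] : (\bigcup_j (sval (VWP a)).2 j) x by rewrite WT.
  by exists j.
- move=> _ [j _ <-]; exists (A j); first by exists j.
  by move=> [a x]; have [+ _ _ _] := svalP (VWP a); apply.
- move=> [a x]; have [_ _ _ /(_ x)] := svalP (VWP a); apply: card_le_trans.
  apply: card_le_trans (card_image_le V _); apply: subset_card_le.
  by move=> _ [[j _ <-] Vx]; exists j.
Qed.

End CoproductDim.

Lemma proximity_dim_smirnov (R : realType) (X : proximityType) :
  proximity_dim R (smirnov X) = proximity_dim R X.
Proof.
rewrite !proximity_dimE; apply: eq_least => n.
apply: iff_sym; exact: prox_dim_le_smirnov.
Qed.

Lemma covering_dim_smirnov (R : realType) (X : proximityType) :
  covering_dim R (induced (smirnov X)) = proximity_dim R (smirnov X).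
Proof.
rewrite proximity_dimE covering_dimE; apply: eq_least => n.
apply: iff_sym; exact: prox_dim_le_covering.
Qed.

Lemma proximity_dim_coproduct (R : realType) (I : Type)
    (X : I -> proximityType) :
  inhabited I -> (forall a, inhabited (X a)) ->
  proximity_dim R (coproduct X) =
    ereal_sup (range (fun a => proximity_dim R (X a))).
Proof.
move=> I0 X0; rewrite proximity_dimE.
under eq_fun do rewrite proximity_dimE.
apply: least_forall => // [a|n]; first exact: prox_dim_le_upward.
exact: prox_dim_le_coproduct.
Qed.

Theorem theorem6p11 (R : realType) (I : Type) (X : I -> proximityType)
    (I_neq0 : inhabited I) (X_neq0 : forall a, inhabited (X a))
    (sepX : forall a, separated_prox (X a)) :
  proximity_dim R (coproduct X) =
    proximity_dim R (coproduct (fun a => smirnov (X a))) /\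
  proximity_dim R (coproduct (fun a => smirnov (X a))) =
    proximity_dim R (smirnov (coproduct X)) /\
  proximity_dim R (smirnov (coproduct X)) =
    covering_dim R (induced (smirnov (coproduct X))) /\
  covering_dim R (induced (smirnov (coproduct X))) =
    ereal_sup (range (fun a => covering_dim R (induced (smirnov (X a))))) /\
  ereal_sup (range (fun a => covering_dim R (induced (smirnov (X a))))) =
    ereal_sup (range (fun a => proximity_dim R (X a))) /\
  ereal_sup (range (fun a => proximity_dim R (X a))) =
    ereal_sup (range (fun a => proximity_dim R (smirnov (X a)))).
Proof.
have smX_neq0 a : inhabited (smirnov (X a)).
  by have [x] := X_neq0 a; exists; exact: point_cluster x.
have coprodE := proximity_dim_coproduct R I X I_neq0 X_neq0.
have coprod_smE :
    proximity_dim R (coproduct (fun a => smirnov (X a))) =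
    ereal_sup (range (fun a => proximity_dim R (X a))).
  rewrite (proximity_dim_coproduct R I _ I_neq0 smX_neq0).
  by under eq_fun do rewrite proximity_dim_smirnov.
have sup_smE : (fun a => proximity_dim R (smirnov (X a))) =
    (fun a => proximity_dim R (X a)).
  by apply/funext => a; exact: proximity_dim_smirnov.
have sup_covE : (fun a => covering_dim R (induced (smirnov (X a)))) =
    (fun a => proximity_dim R (X a)).
  by apply/funext => a; rewrite covering_dim_smirnov proximity_dim_smirnov.
by rewrite covering_dim_smirnov proximity_dim_smirnov sup_covE sup_smE
  coprod_smE coprodE.
Qed.
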